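(* Let $\alpha,\beta\in(0,1)$, $\gamma>0$, $\delta=(1-\beta)^{-1}$ and $u>0$. Let $(X,Y)$ be a random vector such that $X$ and $Y$ both have standard Laplace marginal distributions and such that for all $x>u$ and all $y\in\mathbb{R}$ $$\mathbb{P}(Y>y\mid X=x)=\overline{H}\left(\frac{y-\alpha x}{x^{\beta}}\right),\qquad \overline{H}(z)=\exp\left(-\gamma z^{\delta}\right)\mathbb{1}\{z>0\}+\mathbb{1}\{z\leq 0\}.$$ Let $c=\max\{1,c_0\}\in[1,1/\alpha)$, where $c_0\in(0,1/\alpha)$ satisfies $$\gamma(1-\alpha c_0)^{\delta-1}(\delta-1+\alpha c_0)=c_0^{\delta}.$$ Then the coefficient of asymptotic dependence of $(X,Y)$ is $\chi=0$ and the coefficient of asymptotic independence of $(X,Y)$ is $$\eta=\left(\frac{\gamma(1-\alpha c)^{\delta}}{c^{\delta-1}}+c\right)^{-1}.$$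
   Context: The standard Laplace distribution has density $\tfrac12 e^{-|x|}$ on $\mathbb{R}$. For a random vector $(X,Y)$ with marginal distribution functions $F_X,F_Y$, set $\chi(p)=\mathbb{P}\{Y>F_Y^{-1}(p)\mid X>F_X^{-1}(p)\}$ for $p\in(0,1)$. The coefficient of asymptotic dependence is $\chi=\lim_{p\uparrow1}\chi(p)$ and the coefficient of asymptotic independence is $\eta=\lim_{p\uparrow1}\frac{\log(1-p)}{\log[(1-p)\chi(p)]}$. *)

(* Defs.v *)
From HB Require Import structures.
From mathcomp Require Import all_boot all_order all_algebra.
From mathcomp Require Import all_classical all_reals all_analysis.
Import Order.TTheory GRing.Theory Num.Theory.
Import numFieldTopology.Exports numFieldNormedType.Exports.

Set Implicit Arguments.
Unset Strict Implicit.
Unset Printing Implicit Defensive.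

Local Open Scope classical_set_scope.
Local Open Scope ring_scope.

Definition laplace_pdf (R : realType) (x : R) : R := 2^-1 * expR (- `|x|).

Definition standard_laplace (d : measure_display) (T : measurableType d)
    (R : realType) (P : probability T R) (X : {RV P >-> R}) : Prop :=
  forall A : set R, measurable A ->
    distribution P X A = (\int[lebesgue_measure]_(x in A) (laplace_pdf x)%:E)%E.

(* The kernel [k] is a version of the conditional law of [Y] given [X]: for
   [B] measurable, [k x B] plays the role of P(Y \in B | X = x). *)
Definition regular_conditional_distribution (d : measure_display)
    (T : measurableType d) (R : realType) (P : probability T R)
    (X Y : {RV P >-> R}) (k : R.-pker R ~> R) : Prop :=
  forall A B : set R, measurable A -> measurable B ->
    P (X @^-1` A `&` Y @^-1` B) = (\int[distribution P X]_(x in A) k x B)%E.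

Definition Hbar (R : realType) (gamma delta z : R) : R :=
  expR (- (gamma * z `^ delta)) * (0 < z)%R%:R + (z <= 0)%R%:R.

(* Generalized inverse of the distribution function; meaningful for
   [0 < p < 1], where the set is nonempty and bounded below. *)
Definition quantile (d : measure_display) (T : measurableType d)
    (R : realType) (P : probability T R) (X : {RV P >-> R}) (p : R) : R :=
  inf [set x : R | (p%:E <= cdf X x)%E].

Definition cond_prob (d : measure_display) (T : measurableType d)
    (R : realType) (P : probability T R) (A B : set T) : R :=
  fine (P (A `&` B)) / fine (P B).

Definition chi (d : measure_display) (T : measurableType d)
    (R : realType) (P : probability T R) (X Y : {RV P >-> R}) (p : R) : R :=
  cond_prob P [set w | quantile Y p < Y w] [set w | quantile X p < X w].

Definition asymptotic_dependence_coef (d : measure_display)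
    (T : measurableType d) (R : realType) (P : probability T R)
    (X Y : {RV P >-> R}) (l : R) : Prop :=
  chi X Y p @[p --> (1 : R)^'-] --> l.

Definition asymptotic_independence_coef (d : measure_display)
    (T : measurableType d) (R : realType) (P : probability T R)
    (X Y : {RV P >-> R}) (l : R) : Prop :=
  ln (1 - p) / ln ((1 - p) * chi X Y p) @[p --> (1 : R)^'-] --> l.

(* Main.v *)
Require Import Defs.
From HB Require Import structures.
From mathcomp Require Import all_boot all_order all_algebra.
From mathcomp Require Import all_classical all_reals all_analysis.
From mathcomp Require Import measurable_realfun ring lra.
Import Order.TTheory GRing.Theory Num.Theory.
Import numFieldTopology.Exports numFieldNormedType.Exports.

Local Open Scope classical_set_scope.
Local Open Scope ring_scope.

(** Since beta delta = delta - 1, the exponent of P(Y > t | X = b) e^(-b) is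
    -t phi(b / t) with phi(s) = s + gamma s (((1 - alpha s) / s)_+)^delta, which
    is convex with critical point c0; so its minimum over s >= 1 is
    m := phi(c) > 1.  As P(Y > t | X = x) is nondecreasing in x, the tail
    P(X > t, Y > t) is at least its part on c t < X <= c t + 1, which is of
    order e^(-m t), and at most O(t) e^(-m t): cover ]t, m t] by unit intervals
    and note that P(X > m t) is itself e^(-m t) / 2.  Laplace margins have
    P(X > t) = e^(-t) / 2, whence chi = 0 and eta = 1 / m. *)

(** * Convexity of real powers, and bounds and monotonicity of [Hbar] *)

Lemma powR_div (R : realType) (x y r : R) : 0 <= x -> 0 <= y ->
  (x / y) `^ r = x `^ r / y `^ r.
Proof.
move=> x0 y0; rewrite powRM ?invr_ge0// -(powR_inv1 y0) powRAC.
by rewrite powR_inv1 ?powR_ge0.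
Qed.

(** Young's inequality for the product of [x / a] and [1] with exponent [p], multiplied by
    [p * a^p], is exactly the tangent line bound at [a]. *)
Lemma powR_tangent (R : realType) (p a x : R) :
  1 < p -> 0 < a -> 0 <= x ->
  a `^ p + p * a `^ (p - 1) * (x - a) <= x `^ p.
Proof.
move=> p1 a0 x0.
have p0 : 0 < p by lra.
have q0 : 0 < (1 - p^-1)^-1 by rewrite invr_gt0 subr_gt0 invf_lt1.
have := @conjugate_powR R (x / a) 1 p _ (divr_ge0 x0 (ltW a0)) ler01 p0 q0.
rewrite invrK subrKC powR1 !mulr1 mul1r => /(_ erefl).
rewrite powR_div ?(ltW a0)// => young.
have ap0 : 0 < a `^ p by rewrite powR_gt0.
have -> : a `^ (p - 1) = a `^ p / a.
  by rewrite -(mulr_powRB1 (ltW a0) p0) mulrAC mulfV ?mul1r// gt_eqF.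
have : p * a `^ p * (x / a) <=
    p * a `^ p * (x `^ p / a `^ p / p + (1 - p^-1)).
  by rewrite ler_pM2l// mulr_gt0.
have -> : p * a `^ p * (x `^ p / a `^ p / p + (1 - p^-1)) =
    x `^ p + (p - 1) * a `^ p by field; rewrite !gt_eqF.
have -> : a `^ p + p * (a `^ p / a) * (x - a) =
   p * a `^ p * (x / a) - (p - 1) * a `^ p by field; rewrite !gt_eqF.
by rewrite lerBlDr.
Qed.

Lemma Hbar_le0 (R : realType) (gamma delta z : R) :
  z <= 0 -> Hbar gamma delta z = 1.
Proof. by move=> z0; rewrite /Hbar z0 ltNge z0/= mulr0 add0r. Qed.

Lemma Hbar_gt0 (R : realType) (gamma delta z : R) :
  0 < z -> Hbar gamma delta z = expR (- (gamma * z `^ delta)).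
Proof. by move=> z0; rewrite /Hbar z0 leNgt z0/= mulr1 addr0. Qed.

Lemma Hbar_ge0 (R : realType) (gamma delta z : R) : 0 <= Hbar gamma delta z.
Proof.
have [z0|z0] := leP z 0; first by rewrite Hbar_le0.
by rewrite Hbar_gt0// expR_ge0.
Qed.

Lemma Hbar_le1 (R : realType) (gamma delta z : R) :
  0 <= gamma -> Hbar gamma delta z <= 1.
Proof.
move=> g0; have [z0|z0] := leP z 0; first by rewrite Hbar_le0.
by rewrite Hbar_gt0// -expR0 ler_expR oppr_le0 mulr_ge0 ?powR_ge0.
Qed.

Lemma Hbar_le (R : realType) (gamma delta : R) : 0 <= gamma -> 0 <= delta ->
  {homo Hbar gamma delta : z1 z2 /~ z1 <= z2}.
Proof.
move=> g0 d0 z2 z1 z12; have [z10|z10] := leP z1 0.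
  by rewrite (Hbar_le0 R _ _ z1)// Hbar_le1.
have z20 := lt_le_trans z10 z12.
by rewrite !Hbar_gt0// ler_expR lerN2 ler_wpM2l// ge0_ler_powR// nnegrE ltW.
Qed.

(** * Conditional survival function and minimisation of its exponent *)

Section conditional_survival.
Context (R : realType) (alpha beta gamma delta : R).
Hypotheses (alpha0 : 0 < alpha) (hbeta : 0 < beta < 1) (gamma0 : 0 < gamma).
Hypothesis hdelta : delta = (1 - beta)^-1.

Let beta1 : 0 < 1 - beta. Proof. by case/andP: hbeta => *; lra. Qed.

Lemma delta_gt1 : 1 < delta.
Proof. by rewrite hdelta invf_gt1//; case/andP: hbeta => *; lra. Qed.

Lemma beta_delta : beta * delta = delta - 1.
Proof. by rewrite hdelta; field; rewrite gt_eqF. Qed.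

Definition csurv (x y : R) : R :=
  Hbar gamma delta ((y - alpha * x) / x `^ beta).

Lemma csurv_ge0 x y : 0 <= csurv x y. Proof. exact: Hbar_ge0. Qed.

Lemma csurv_le1 x y : csurv x y <= 1.
Proof. exact/Hbar_le1/ltW. Qed.

(** Raising [x] lowers the numerator [t - alpha x] and raises the denominator [x^beta], so the
    argument of [Hbar] falls while the numerator is positive; once it is nonpositive the value is
    the maximum 1. *)
Lemma csurv_mono (t x b : R) : 0 < x -> x <= b -> csurv x t <= csurv b t.
Proof.
move=> x0 xb; have b0 := lt_le_trans x0 xb.
have axb : alpha * x <= alpha * b by rewrite ler_pM2l.
have [tb|tb] := leP (t - alpha * b) 0.
  rewrite {2}/csurv Hbar_le0 ?csurv_le1// mulr_le0_ge0// invr_ge0.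
  exact: powR_ge0.
apply: Hbar_le; [exact: ltW | exact/ltW/(lt_trans ltr01 delta_gt1) |].
apply: ler_pM; rewrite ?invr_ge0 ?powR_ge0 ?(ltW tb)//; first lra.
rewrite lef_pV2 ?posrE ?powR_gt0// ge0_ler_powR ?nnegrE ?(ltW x0) ?(ltW b0)//.
by case/andP: hbeta => /ltW.
Qed.

(** Since [beta * delta = delta - 1], the factor [b^(- beta delta)] equals [b * b^(- delta)]; the
    exponent becomes homogeneous of degree one in [(t, b)]. *)
Lemma csurv_gt0 (t b : R) : 0 < b -> 0 < t - alpha * b ->
  csurv b t = expR (- (gamma * (b * ((t - alpha * b) / b) `^ delta))).
Proof.
move=> b0 tb; rewrite /csurv Hbar_gt0 ?divr_gt0 ?powR_gt0//.
congr (expR (- (gamma * _))).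
have d0 : 0 < delta := lt_trans ltr01 delta_gt1.
rewrite !powR_div ?powR_ge0 ?(ltW tb) ?(ltW b0)// -powRrM beta_delta.
rewrite -(mulr_powRB1 (ltW b0) d0).
have bd0 : 0 < b `^ (delta - 1) by rewrite powR_gt0.
by field; rewrite !gt_eqF.
Qed.

Context (c0 c : R).
Hypothesis hc0 : 0 < c0 < alpha^-1.
Hypothesis hc0eq : gamma * (1 - alpha * c0) `^ (delta - 1) * (delta - 1 + alpha * c0)
             = c0 `^ delta.
Hypothesis hc : c = Num.max 1 c0.
Hypothesis alpha1 : alpha < 1.

Let m := gamma * (1 - alpha * c) `^ delta / c `^ (delta - 1) + c.

Lemma c_ge1 : 1 <= c. Proof. by rewrite hc le_max lexx. Qed.

Let c_gt0 : 0 < c := lt_le_trans ltr01 c_ge1.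

Lemma one_sub_alpha_c_gt0 : 0 < 1 - alpha * c.
Proof.
rewrite subr_gt0 mulrC -ltr_pdivlMr// mul1r hc gt_max.
by case/andP: hc0 => _ ->; rewrite invf_gt1 // alpha1.
Qed.

(** The value at [c] of the function being minimised, in the form to which a tangent in
    [z = (1 - alpha c) / c] applies. *)
Let m_alt : m = gamma * (c * ((1 - alpha * c) / c) `^ delta) + c.
Proof.
rewrite /m powR_div ?(ltW one_sub_alpha_c_gt0) ?(ltW c_gt0)//.
rewrite -[c `^ delta]mulr_powRB1 ?(ltW c_gt0) ?(lt_trans ltr01 delta_gt1)//.
have cd0 : 0 < c `^ (delta - 1) by rewrite powR_gt0.
by field; rewrite !gt_eqF.
Qed.

(** The term added to [c] is positive because [alpha c < 1]. The gap [m - 1] is what forces chi to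
    vanish. *)
Lemma decay_rate_gt1 : 1 < m.
Proof.
rewrite /m (@le_lt_trans _ _ c)// ?c_ge1// ltrDr.
by rewrite divr_gt0 ?mulr_gt0 ?powR_gt0 ?one_sub_alpha_c_gt0.
Qed.

(* [k] is the slope at [c] of s |-> s + gamma s ((1 - alpha s) / s)^delta; it
   vanishes at [c0] and increases with [c]. *)
Let slope : let z := (1 - alpha * c) / c in
  let k := 1 - gamma * z `^ (delta - 1) * (delta * alpha + (delta - 1) * z) in
  0 <= k /\ (1 < c -> k = 0).
Proof.
have d1 := delta_gt1.
case/andP: (hc0) => c00 c0a.
have ac0 : 0 < 1 - alpha * c0 by rewrite subr_gt0 mulrC -ltr_pdivlMr// mul1r.
pose f z := gamma * z `^ (delta - 1) * (delta * alpha + (delta - 1) * z).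
(* This is [hc0eq] divided by [c0^delta]. *)
have f0 : f ((1 - alpha * c0) / c0) = 1.
  rewrite /f powR_div ?(ltW ac0) ?(ltW c00)//.
  have cd0 : 0 < c0 `^ (delta - 1) by rewrite powR_gt0.
  transitivity (gamma * (1 - alpha * c0) `^ (delta - 1) *
     (delta - 1 + alpha * c0) / (c0 * c0 `^ (delta - 1))).
    by field; rewrite !gt_eqF.
  rewrite hc0eq mulr_powRB1 ?(ltW c00)//; last lra.
  by rewrite mulfV// gt_eqF// powR_gt0.
have [c01|c01] := leP c0 1; last first.
  have -> : c = c0 by rewrite hc; apply/max_idPr/ltW.
  by move=> z k; have -> : k = 0 by rewrite /k -/(f z) f0 subrr.
have c1 : c = 1 by rewrite hc; apply/max_idPl.
rewrite c1 ltxx; split => //.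
have z0 : 0 <= (1 - alpha * 1) / 1 by rewrite divr1 mulr1 subr_ge0 ltW.
have z01 : (1 - alpha * 1) / 1 <= (1 - alpha * c0) / c0.
  rewrite divr1 ler_pdivlMr//; nra.
rewrite subr_ge0 -[leRHS]f0 /f; apply: ler_pM.
- by rewrite mulr_ge0 ?powR_ge0 ?(ltW gamma0).
- apply: addr_ge0; apply: mulr_ge0 => //; [lra | exact: ltW | lra].
- rewrite ler_wpM2l ?(ltW gamma0)// ge0_ler_powR ?nnegrE ?(le_trans z0 z01)//; lra.
- by rewrite lerD2l ler_wpM2l//; lra.
Qed.

(** Replacing [v^delta] by its tangent at [z], then [b v] by [t - alpha b], bounds the right side
    below by [m t + k (b - c t)]. Allowing any [v >= 0] with [b v >= t - alpha b] lets [v = 0] cover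
    the range [alpha b >= t]. *)
Lemma rate_le (t b v : R) : 0 < t -> t <= b -> 0 <= v -> t - alpha * b <= b * v ->
  m * t <= gamma * (b * v `^ delta) + b.
Proof.
move=> t0 tb v0 tv; have b0 := lt_le_trans t0 tb.
have d1 := delta_gt1.
rewrite m_alt; have [] := slope.
set z := (_ / c) => k0 k1.
have z0 : 0 < z by rewrite divr_gt0// one_sub_alpha_c_gt0.
have cz : c * z = 1 - alpha * c by rewrite mulrC divfK// gt_eqF.
have := powR_tangent R _ _ _ d1 z0 v0.
rewrite -(mulr_powRB1 (ltW z0)) ?(lt_trans ltr01 d1)//.
set Z := z `^ (delta - 1) in k0 k1 *; set V := v `^ delta => tangent.
have Z0 : 0 <= Z by apply: powR_ge0.
have tan2 : gamma * (b * (z * Z + delta * Z * (v - z))) <= gamma * (b * V).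
  by rewrite ler_pM2l// ler_pM2l.
have lin : gamma * (delta * Z) * (t - alpha * b) <= gamma * (delta * Z) * (b * v).
  by rewrite ler_wpM2l// mulr_ge0 ?(ltW gamma0)// mulr_ge0//; lra.
set k := 1 - _ in k0 k1.
(* Complementary slackness: either the minimum is interior and [k = 0], or [c = 1] and [b >= t] is
   the constraint itself. *)
have kbc : 0 <= k * (b - c * t).
  have [c1|c1] := ltP 1 c; first by rewrite k1// mul0r.
  have -> : c = 1 by apply/eqP; rewrite eq_le c1 c_ge1.
  by rewrite mulr_ge0// mul1r subr_ge0.
have E : gamma * (c * (z * Z)) = gamma * Z * (1 - alpha * c) by rewrite -cz; ring.
have E2 : k * (c * t) = t * (c - gamma * Z * (delta * (alpha * c) + (delta - 1) * (1 - alpha * c))).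
  by rewrite -cz /k; ring.
rewrite E; rewrite mulrBr E2 /k in kbc; nra.
Qed.

Lemma csurv_le (t b : R) : 0 < t -> t <= b -> csurv b t * expR (- b) <= expR (- (m * t)).
Proof.
move=> t0 tb; have b0 := lt_le_trans t0 tb.
have [tab|tab] := leP (t - alpha * b) 0.
  rewrite /csurv Hbar_le0 ?mul1r; last first.
    by rewrite mulr_le0_ge0// invr_ge0 powR_ge0.
  rewrite ler_expR lerN2.
  (* Here the survival factor is 1 and the positive part of [(t - alpha b) / b] is 0. *)
  have := @rate_le t b 0 t0 tb (lexx 0); rewrite mulr0 => /(_ tab).
  by rewrite powR0 ?gt_eqF ?(lt_trans ltr01 delta_gt1)// !mulr0 add0r.
rewrite csurv_gt0// -expRD ler_expR -opprD lerN2 rate_le ?divr_ge0 ?(ltW tab) ?(ltW b0)//.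
by rewrite [b * _]mulrC divfK// gt_eqF.
Qed.

(** By homogeneity the exponent at [b = c t] is [t] times its value at [c], so the bound of
    [csurv_le] is attained whenever [c t] is admissible. *)
Lemma csurv_at_c (t : R) : 0 < t -> csurv (c * t) t * expR (- (c * t)) = expR (- (m * t)).
Proof.
move=> t0; have e : t - alpha * (c * t) = t * (1 - alpha * c) by ring.
rewrite csurv_gt0 ?mulr_gt0// e ?mulr_gt0 ?one_sub_alpha_c_gt0//.
rewrite -expRD m_alt; congr expR.
have -> : t * (1 - alpha * c) / (c * t) = (1 - alpha * c) / c by field; rewrite !gt_eqF.
ring.
Qed.

End conditional_survival.

(** * Tails, interval masses and quantiles of the Laplace law *)

Section laplace.
Context (d : measure_display) (T : measurableType d) (R : realType)
  (P : probability T R) (X : {RV P >-> R}).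
Hypothesis hX : standard_laplace X.

Lemma laplace_ccdf (t : R) : 0 <= t -> ccdf X t = (2^-1 * expR (- t))%:E.
Proof.
move=> t0; rewrite /ccdf hX//.
have cexp : continuous (fun x : R => 2^-1 * expR (- x)).
  move=> x; apply: cvgMr.
  by apply: continuous_comp; [exact: continuousN | exact: continuous_expR].
have -> : (\int[lebesgue_measure]_(x in `]t, +oo[) (laplace_pdf x)%:E =
    \int[lebesgue_measure]_(x in `]t, +oo[) (2^-1 * expR (- x))%:E)%E.
  apply: eq_integral => x; rewrite inE/= in_itv/= andbT => tx.
  by rewrite /laplace_pdf ger0_norm// (le_trans t0)// ltW.
rewrite integral_itv_obnd_cbnd; last first.
  apply/measurable_EFinP/measurable_funTS.
  exact: continuous_measurable_fun.
rewrite (@ge0_continuous_FTC2y _ _ (fun x => - (2^-1 * expR (- x))) t 0).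
- by rewrite sub0e EFinN oppeK.
- by move=> x _; rewrite mulr_ge0// expR_ge0.
- exact: continuous_subspaceT.
- rewrite -oppr0; apply: cvgN; rewrite -(mulr0 2^-1); apply: cvgMr.
  exact: cvgr_expR.
- by move=> x _; exact: ex_derive.
- by apply: cvg_at_right_filter; apply: cvgN; exact: cexp.
- move=> x _; rewrite derive1E.
  have dexp : is_derive x 1 (fun x : R => expR (- x)) (expR (- x) * -1).
    exact: (@is_derive1_comp _ expR -%R).
  have := is_deriveN (is_deriveZ 2^-1 dexp).
  move=> H; rewrite (@derive_val _ _ _ _ _ _ _ H).
  by rewrite mulrN1 scalerN opprK.
Qed.

Lemma laplace_cdf (t : R) : 0 <= t -> cdf X t = (1 - 2^-1 * expR (- t))%:E.
Proof. by move=> t0; rewrite cdf_1_ccdf laplace_ccdf. Qed.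

Lemma laplace_itv (a b : R) : 0 <= a -> a <= b ->
  distribution P X `]a, b] = (2^-1 * (expR (- a) - expR (- b)))%:E.
Proof.
move=> a0 ab; have b0 := le_trans a0 ab.
have : cdf X b = (cdf X a + distribution P X `]a, b])%E.
  rewrite /cdf -measureU//.
    by rewrite -itv_bndbnd_setU.
  apply/seteqP; split => // x [/=]; rewrite !in_itv/= => xa /andP[].
  by rewrite ltNge xa.
rewrite !laplace_cdf// => /esym.
rewrite -(fineK (fin_num_measure (distribution P X) `]a, b]%classic _))//.
rewrite -EFinD => -[] e; congr EFin; lra.
Qed.

Lemma laplace_quantile (t : R) : 0 < t ->
  quantile X (1 - 2^-1 * expR (- t)) = t.
Proof.
move=> t0; rewrite /quantile.
have -> : [set x : R | ((1 - 2^-1 * expR (- t))%:E <= cdf X x)%E] = `[t, +oo[%classic.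
  apply/seteqP; split=> x /=; rewrite in_itv/= andbT; last first.
    move=> tx; rewrite laplace_cdf ?(le_trans (ltW t0))// lee_fin.
    by rewrite lerD2l lerN2 ler_pM2l// ler_expR lerN2.
  apply: contraTT; rewrite -!ltNge => xt.
  have [x0|x0] := leP 0 x.
    rewrite laplace_cdf// lte_fin ltrD2l ltrN2 ltr_pM2l// ltr_expR.
    by rewrite ltrN2.
  (* The closed form of the cdf is available only from 0 on; a negative [x] is compared with 0, and
     [0 < t] keeps the inequality strict. *)
  apply: (@le_lt_trans _ _ (cdf X 0)); first exact/cdf_nondecreasing/ltW.
  rewrite laplace_cdf// lte_fin ltrD2l ltrN2 ltr_pM2l// ltr_expR.
  by rewrite ltrN2.
by rewrite inf_itv.
Qed.

End laplace.

(** * Joint probabilities from pointwise bounds on the kernel *)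

Section disintegration.
Context (d : measure_display) (T : measurableType d) (R : realType)
  (P : probability T R) (X Y : {RV P >-> R}) (kappa : R.-pker R ~> R).
Hypothesis hkappa : regular_conditional_distribution X Y kappa.

Lemma joint_le (A B : set R) (r : R) : measurable A -> measurable B -> 0 <= r ->
  (forall x, A x -> (kappa x B <= r%:E)%E) ->
  (P (X @^-1` A `&` Y @^-1` B) <= r%:E * distribution P X A)%E.
Proof.
move=> mA mB r0 kr; rewrite hkappa// -integral_cst//.
apply: ge0_le_integral => //.
exact: measurable_funTS (measurable_kernel kappa B mB).
Qed.

Lemma joint_ge (A B : set R) (r : R) : measurable A -> measurable B -> 0 <= r ->
  (forall x, A x -> (r%:E <= kappa x B)%E) ->
  (r%:E * distribution P X A <= P (X @^-1` A `&` Y @^-1` B))%E.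
Proof.
move=> mA mB r0 kr; rewrite hkappa// -integral_cst//.
apply: ge0_le_integral => //.
exact: measurable_funTS (measurable_kernel kappa B mB).
Qed.

End disintegration.

(** * Two-sided bounds on the joint tail, for an abstract survival function [s] *)

Section joint_tail.
Context (d : measure_display) (T : measurableType d) (R : realType)
  (P : probability T R) (X Y : {RV P >-> R}) (kappa : R.-pker R ~> R)
  (u : R) (s : R -> R -> R) (m c : R).
Hypotheses (u0 : 0 < u) (hX : standard_laplace X)
  (hkappa : regular_conditional_distribution X Y kappa)
  (hcond : forall x : R, u < x -> forall y : R,
     kappa x `]y, +oo[%classic = (s x y)%:E)
  (s_ge0 : forall x y : R, 0 <= s x y)
  (s_mono : forall t x b : R, 0 < x -> x <= b -> s x t <= s b t)
  (s_le : forall t b : R, 0 < t -> t <= b -> s b t * expR (- b) <= expR (- (m * t)))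
  (c1 : 1 <= c)
  (s_c : forall t : R, 0 < t -> s (c * t) t * expR (- (c * t)) = expR (- (m * t)))
  (m1 : 1 < m).

Let mpre (Z : {RV P >-> R}) (A : set R) : measurable A -> measurable (Z @^-1` A).
Proof. by move=> mA; rewrite -[_ @^-1` _]setTI; exact: measurable_funP. Qed.

(** On the strip [c t < X <= c t + 1] the kernel is at least [s (c t) t] by monotonicity, and the
    strip has mass [e^(- c t) (1 - e^(-1)) / 2]; [s_c] evaluates the product. *)
Lemma joint_tail_ge (t : R) : u < t ->
  ((2^-1 * (1 - expR (-1)) * expR (- (m * t)))%:E <=
   P (X @^-1` `]t, +oo[ `&` Y @^-1` `]t, +oo[))%E.
Proof.
move=> ut; have t0 := lt_trans u0 ut.
have tct : t <= c * t by rewrite ler_peMl// ltW.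
apply: (@le_trans _ _ (P (X @^-1` `]c * t, c * t + 1] `&` Y @^-1` `]t, +oo[))); last first.
  apply: le_measure; rewrite ?inE; try by apply: measurableI; [exact: mpre|exact: mpre].
  move=> w [/=]; rewrite !in_itv/= !andbT => /andP[ctX _] ?; split => //.
  exact: le_lt_trans ctX.
apply: le_trans (joint_ge _ _ _ _ _ _ _ hkappa _ _ (s (c * t) t) _ _ _ _) => //.
  rewrite laplace_itv// ?(le_trans (ltW t0))//; last lra.
  rewrite -EFinM lee_fin -s_c// opprD expRD; lra.
move=> x /=; rewrite in_itv/= => /andP[ctx _].
rewrite hcond; last exact: (lt_trans ut (le_lt_trans tct ctx)).
rewrite lee_fin; apply: s_mono (ltW ctx).
exact: lt_le_trans t0 tct.
Qed.

(** Each unit interval ending at [b] contributes at most [s b t] times its mass, which is below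
    [e * e^(- b) / 2]; the factor [e] pays for the distance between its endpoints, and [s_le] bounds
    the rest uniformly in [b]. *)
Lemma joint_tail_le_unif (t : R) (n : nat) : u < t ->
  (P (X @^-1` `]t, (t + n%:R)%R] `&` Y @^-1` `]t, +oo[) <=
   (2^-1 * expR 1 * n%:R * expR (- (m * t)))%:E)%E.
Proof.
move=> ut; have t0 := lt_trans u0 ut.
elim: n => [|n IH].
  by rewrite addr0 set_itvoc0 preimage_set0 set0I measure0 mulr0 mul0r.
have n0 : 0 <= n%:R :> R by [].
have -> : X @^-1` `]t, t + n.+1%:R] `&` Y @^-1` `]t, +oo[ =
    (X @^-1` `]t, t + n%:R] `&` Y @^-1` `]t, +oo[) `|`
    (X @^-1` `]t + n%:R, t + n.+1%:R] `&` Y @^-1` `]t, +oo[).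
  rewrite -setIUl -preimage_setU -itv_bndbnd_setU// bnd_simp.
    by rewrite lerDl.
  by rewrite lerD2l ler_nat.
apply: (le_trans (measureU2 _ _ _)).
- by apply: measurableI; [exact: mpre|exact: mpre].
- by apply: measurableI; [exact: mpre|exact: mpre].
have -> : (2^-1 * expR 1 * n.+1%:R * expR (- (m * t)))%:E =
  ((2^-1 * expR 1 * n%:R * expR (- (m * t)))%:E + (2^-1 * expR 1 * expR (- (m * t)))%:E)%E.
  by rewrite -EFinD; congr EFin; rewrite -natr1; ring.
apply: leeD => //.
set b := t + n.+1%:R.
have nn : t + n%:R = b - 1 by rewrite /b -natr1; ring.
have tb : t <= b by rewrite lerDl.
apply: le_trans (joint_le _ _ _ _ _ _ _ hkappa _ _ (s b t) _ _ _ _) _ => //.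
  move=> x /=; rewrite in_itv/= => /andP[nx xb].
  have tx : t < x by apply: le_lt_trans nx; rewrite lerDl.
  by rewrite hcond ?(lt_trans ut)// lee_fin s_mono// (lt_trans t0 tx).
rewrite laplace_itv//; last 2 first.
  by rewrite addr_ge0// ltW.
  by rewrite lerD2l ler_nat.
rewrite nn -EFinM lee_fin opprB addrC expRD.
have := s_le t b t0 tb.
have e1 : 0 < expR 1 :> R by exact: expR_gt0.
rewrite -(ler_pM2l e1) => sb.
have := mulr_ge0 (s_ge0 b t) (expR_ge0 (- b)).
lra.
Qed.

Lemma joint_tail_le (t : R) : u < t ->
  (P (X @^-1` `]t, +oo[ `&` Y @^-1` `]t, +oo[) <=
   (2^-1 * (expR 1 * ((m - 1) * t + 1) + 1) * expR (- (m * t)))%:E)%E.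
Proof.
move=> ut; have t0 := lt_trans u0 ut.
have mt0 : 0 <= (m - 1) * t by rewrite mulr_ge0 ?ltW// subr_gt0.
(* The successor makes [t + n >= m t], so that the marginal tail beyond [t + n] is at most
   [e^(- m t) / 2], while [n] stays below [(m - 1) t + 1]. *)
pose n := (Num.truncn ((m - 1) * t)).+1.
have nle : n%:R <= (m - 1) * t + 1.
  by rewrite /n -natr1 lerD2r truncn_le.
have nge : (m - 1) * t <= n%:R.
  by rewrite ltW// truncnS_gt.
apply: (@le_trans _ _ (P (X @^-1` `]t, (t + n%:R)%R] `&` Y @^-1` `]t, +oo[) +
    P (X @^-1` `](t + n%:R)%R, +oo[))%E).
  apply: (le_trans _ (measureU2 _ _ _)) => //.
  - apply: le_measure; rewrite ?inE.
    + by apply: measurableI; [exact: mpre|exact: mpre].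
    + apply: measurableU; last exact: mpre.
      by apply: measurableI; [exact: mpre|exact: mpre].
    + move=> w [/=]; rewrite !in_itv/= !andbT => tX tY.
      by have [Xn|Xn] := leP (X w) (t + n%:R); [left; rewrite tX | right].
  - by apply: measurableI; [exact: mpre|exact: mpre].
  - exact: mpre.
have -> : P (X @^-1` `]t + n%:R, +oo[) = ccdf X (t + n%:R) by [].
rewrite laplace_ccdf//; last by rewrite addr_ge0// ltW.
apply: (le_trans (leeD (joint_tail_le_unif _ n ut) (le_refl _))).
rewrite -EFinD lee_fin.
have e1 : 0 < expR 1 :> R by exact: expR_gt0.
have em : expR (- (t + n%:R)) <= expR (- (m * t)) by rewrite ler_expR; lra.
have ne : expR 1 * n%:R * expR (- (m * t)) <= expR 1 * ((m - 1) * t + 1) * expR (- (m * t)).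
  by rewrite ler_pM2r ?expR_gt0// ler_pM2l.
lra.
Qed.

End joint_tail.

(** * Limits as [p] tends to 1, on the scale [L p = - ln (1 - p)] *)

Lemma cvg_Nln1B (R : realType) : - ln (1 - p) @[p --> (1 : R)^'-] --> +oo.
Proof.
apply/cvgryPge => A; near=> p.
have p1 : p < 1 by near: p; exact: nbhs_left_lt.
have pA : 1 - expR (- A) < p.
  by near: p; apply: nbhs_left_gt; rewrite ltrBlDr ltrDl expR_gt0.
rewrite lerNr -[leRHS]expRK ler_ln ?posrE ?expR_gt0 ?subr_gt0//; lra.
Unshelve. all: by end_near. Qed.

(** Sublinearity of [ln] at the square root; it makes the polynomial factor [L p] negligible after
    taking logarithms. *)
Lemma ln_le_sqrt (R : realType) (x : R) : 0 < x -> ln x <= 2 * Num.sqrt x.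
Proof.
move=> x0; rewrite -{1}(sqr_sqrtr (ltW x0)) lnXn ?sqrtr_gt0// mulr2n.
have : ln (Num.sqrt x) < Num.sqrt x by rewrite ln_sublinear ?sqrtr_gt0.
lra.
Qed.

Section exponential_rate.
Context (R : realType) (J : R -> R) (m C K : R).
Hypotheses (m1 : 1 < m) (C0 : 0 < C) (K0 : 0 < K).
Local Notation L p := (- ln (1 - p)).
Hypothesis hJ : \forall p \near (1 : R)^'-,
  C * expR (- (m * L p)) <= J p <= K * L p * expR (- (m * L p)).

Let cvgLV : (L p)^-1 @[p --> (1 : R)^'-] --> (0 : R).
Proof.
apply/gtr0_cvgV0; last exact: cvg_Nln1B.
by have /cvgryPgt/(_ 0) := cvg_Nln1B R.
Qed.

Let nearL (A : R) : \forall p \near (1 : R)^'-, A <= L p.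
Proof. by have /cvgryPge/(_ A) := cvg_Nln1B R. Qed.

Lemma cvg_rate_div : J p / (1 - p) @[p --> (1 : R)^'-] --> (0 : R).
Proof.
(* As [1 - p = e^(- L)], the quotient is at most [K L e^(- 2 a L)]. Each of the two factors
   [e^(- a L)] is at most [1 / (a L)], which leaves [K / (a^2 L)]. *)
pose a := (m - 1) / 2.
have a0 : 0 < a by rewrite divr_gt0// subr_gt0.
apply: (@squeeze_cvgr _ _ _ _ (fun=> 0) (fun p => (K / a ^+ 2) * (L p)^-1)); last 2 first.
- exact: cvg_cst.
- by rewrite -(mulr0 (K / a ^+ 2)); apply: cvgMr.
near=> p.
have p1 : 0 < 1 - p by rewrite subr_gt0; near: p; exact: nbhs_left_lt.
have L1 : 1 <= L p by near: p; exact: nearL.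
have /andP[Jge Jle] : C * expR (- (m * L p)) <= J p <= K * L p * expR (- (m * L p)).
  by near: p.
have pE : 1 - p = expR (- L p) by rewrite opprK lnK.
set l := L p in L1 Jge Jle pE *; have l0 : 0 < l by lra.
apply/andP; split.
  by rewrite divr_ge0 ?(ltW p1)// (le_trans _ Jge)// mulr_ge0 ?expR_ge0 ?ltW.
rewrite ler_pdivrMr// (le_trans Jle)// pE.
have -> : K / a ^+ 2 / l * expR (- l) = K * ((a ^+ 2)^-1 / l) * expR (- l) by ring.
have -> : - (m * l) = - (a * l) + (- (a * l)) + (- l) by rewrite /a; field.
rewrite !expRD mulrA ler_pM2r ?expR_gt0// -mulrA ler_pM2l//.
have al : 0 < a * l by rewrite mulr_gt0.
have e : expR (- (a * l)) <= (a * l)^-1.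
  rewrite expRN lef_pV2 ?posrE ?expR_gt0//.
  by apply: le_trans (expR_ge1Dx _); rewrite lerDr.
have -> : (a ^+ 2)^-1 / l = l * ((a * l)^-1 * (a * l)^-1).
  by field; rewrite !gt_eqF.
by rewrite ler_pM2l// ler_pM ?expR_ge0.
Unshelve. all: by end_near. Qed.

Lemma cvg_rate_ln : ln (1 - p) / ln (J p) @[p --> (1 : R)^'-] --> m^-1.
Proof.
have cG : - ln (J p) / L p @[p --> (1 : R)^'-] --> m.
  (* Logarithms of [hJ] divided by [L]; the term [ln L / L] is bounded by [2 / sqrt L]. *)
  apply: (@squeeze_cvgr _ _ _ _ (fun p => m - ln K * (L p)^-1 - 2 * Num.sqrt (L p)^-1)
     (fun p => m - ln C * (L p)^-1)); last 2 first.
  - rewrite -[X in _ --> X]subr0 -[X in _ --> X - _]subr0.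
    rewrite -[X in _ --> m - X - _](mulr0 (ln K)) -[X in _ --> _ - X](mulr0 2).
    apply: cvgB; first by apply: cvgB; [exact: cvg_cst | exact: cvgMr].
    apply: cvgMr; rewrite -(@sqrtr0 R); apply: continuous_cvg => //.
    exact: sqrt_continuous.
  - rewrite -[X in _ --> X]subr0 -[X in _ --> m - X](mulr0 (ln C)).
    by apply: cvgB; [exact: cvg_cst | exact: cvgMr].
  near=> p.
  have L1 : 1 <= L p by near: p; exact: nearL.
  have /andP[Jge Jle] : C * expR (- (m * L p)) <= J p <= K * L p * expR (- (m * L p)).
    by near: p.
  set l := L p in L1 Jge Jle *; have l0 : 0 < l by lra.
  have e0 : 0 < expR (- (m * l)) by exact: expR_gt0.
  have J0 : 0 < J p by apply: lt_le_trans Jge; rewrite mulr_gt0.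
  have Kl : 0 < K * l by rewrite mulr_gt0.
  move: Jge; rewrite -ler_ln ?posrE ?mulr_gt0// lnM ?posrE// expRK => Jge.
  move: Jle; rewrite -ler_ln ?posrE ?mulr_gt0// lnM ?posrE// expRK lnM ?posrE// => Jle.
  have := ln_le_sqrt R l l0.
  have sE : Num.sqrt l^-1 = Num.sqrt l / l.
    have s0 : 0 < Num.sqrt l by rewrite sqrtr_gt0.
    rewrite sqrtrV ?(ltW l0)// -{3}(sqr_sqrtr (ltW l0)); field.
    by rewrite gt_eqF.
  rewrite sE => lnl; apply/andP; split.
    rewrite ler_pdivlMr//.
    have -> : (m - ln K / l - 2 * (Num.sqrt l / l)) * l = m * l - ln K - 2 * Num.sqrt l.
      by field; rewrite gt_eqF.
    lra.
  rewrite ler_pdivrMr//.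
  have -> : (m - ln C / l) * l = m * l - ln C by field; rewrite gt_eqF.
  lra.
have : (- ln (J p) / L p)^-1 @[p --> (1 : R)^'-] --> m^-1.
  by apply: cvgV => //; rewrite gt_eqF// (lt_trans ltr01).
apply: cvg_trans; apply: near_eq_cvg; near=> p.
by rewrite invf_div invrN mulrNN.
Unshelve. all: by end_near. Qed.

End exponential_rate.

(** * From joint tails at a level [t] to the two coefficients *)

Theorem mainTheorem5 (R : realType) (d : measure_display)
  (T : measurableType d) (P : probability T R) (X Y : {RV P >-> R})
  (kappa : R.-pker R ~> R)
  (alpha beta gamma delta u c0 c : R)
  (halpha : 0 < alpha < 1) (hbeta : 0 < beta < 1) (hgamma : 0 < gamma)
  (hdelta : delta = (1 - beta)^-1) (hu : 0 < u)
  (hX : standard_laplace X) (hY : standard_laplace Y)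
  (hkappa : regular_conditional_distribution X Y kappa)
  (hcond : forall x : R, u < x -> forall y : R,
     kappa x [set z : R | y < z]
       = (Hbar gamma delta ((y - alpha * x) / x `^ beta))%:E)
  (hc0 : 0 < c0 < alpha^-1)
  (hc0eq : gamma * (1 - alpha * c0) `^ (delta - 1) * (delta - 1 + alpha * c0)
             = c0 `^ delta)
  (hc : c = Num.max 1 c0) :
  asymptotic_dependence_coef X Y 0 /\
  asymptotic_independence_coef X Y
    (gamma * (1 - alpha * c) `^ delta / c `^ (delta - 1) + c)^-1.
Proof.
case/andP: (halpha) => alpha0 alpha1.
set m := _ + c.
have m1 : 1 < m := decay_rate_gt1 _ _ _ _ alpha0 hgamma _ _ hc0 hc alpha1.
pose J p := fine (P ([set w | quantile Y p < Y w] `&` [set w | quantile X p < X w])).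
(* With [1 - p = e^(- t) / 2] one has [L = t + ln 2], so passing from [e^(- m t)] to [e^(- m L)]
   costs [e^(m ln 2)]. *)
pose C := 2^-1 * (1 - expR (-1)) * expR (m * ln 2).
pose K := 2^-1 * (expR 1 * m + 1) * expR (m * ln 2).
have C0 : 0 < C.
  by rewrite !mulr_gt0 ?expR_gt0// subr_gt0 -[ltRHS]expR0 ltr_expR; lra.
have K0 : 0 < K.
  rewrite !mulr_gt0 ?expR_gt0// addr_gt0// mulr_gt0 ?expR_gt0//; lra.
have ray t : [set z : R | t < z] = `]t, +oo[%classic.
  by apply/seteqP; split=> z; rewrite /= in_itv/= andbT.
have hcond' x : u < x -> forall y, kappa x `]y, +oo[%classic =
    (csurv R alpha beta gamma delta x y)%:E.
  by move=> ux y; rewrite -ray hcond.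
(* The last bound puts the quantile [t = L - ln 2] above [u]; [1 <= L] lets additive constants be
   absorbed into multiples of [L]. *)
have large : \forall p \near (1 : R)^'-, [/\ p < 1, 1 <= - ln (1 - p) & u + ln 2 < - ln (1 - p)].
  near=> p; split.
  - by near: p; exact: nbhs_left_lt.
  - by near: p; have /cvgryPge/(_ 1) := cvg_Nln1B R.
  - by near: p; have /cvgryPgt/(_ (u + ln 2)) := cvg_Nln1B R.
have quant p : p < 1 -> u + ln 2 < - ln (1 - p) ->
    exists t, [/\ u < t, p = 1 - 2^-1 * expR (- t) & - ln (1 - p) = t + ln 2].
  move=> p1 pu; exists (- ln (1 - p) - ln 2).
  split; [lra | | ring].
  rewrite opprB opprK addrC expRD !lnK ?posrE ?subr_gt0//; lra.
have hJ : \forall p \near (1 : R)^'-,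
    C * expR (- (m * - ln (1 - p))) <= J p <= K * - ln (1 - p) * expR (- (m * - ln (1 - p))).
  near=> p.
  have [p1 L1 Lu] : [/\ p < 1, 1 <= - ln (1 - p) & u + ln 2 < - ln (1 - p)] by near: p.
  have [t [ut pE LE]] := quant p p1 Lu.
  have t0 : 0 < t := lt_trans hu ut.
  have -> : J p = fine (P (X @^-1` `]t, +oo[ `&` Y @^-1` `]t, +oo[)).
    (* Equal margins give [X] and [Y] the same quantile [t]. *)
    by rewrite /J pE !laplace_quantile// setIC -ray.
  have fin : (P (X @^-1` `]t, +oo[ `&` Y @^-1` `]t, +oo[)) \is a fin_num.
    apply: fin_num_measure; apply: measurableI.
      by rewrite -[_ @^-1` _]setTI; exact: measurable_funP.
    by rewrite -[_ @^-1` _]setTI; exact: measurable_funP.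
  have smono := csurv_mono _ _ _ _ _ alpha0 hbeta hgamma hdelta.
  have sle := csurv_le _ _ _ _ _ alpha0 hbeta hgamma hdelta _ _ hc0 hc0eq hc alpha1.
  have sc := csurv_at_c _ _ _ gamma _ alpha0 hbeta hdelta _ _ hc0 hc alpha1.
  have lo := joint_tail_ge _ _ _ _ _ _ _ _ _ m _ hu hX hkappa hcond'
    (csurv_ge0 _ _ _ _ _) smono (c_ge1 _ _ _ hc) sc t ut.
  have up := joint_tail_le _ _ _ _ _ _ _ _ _ m hu hX hkappa hcond'
    (csurv_ge0 _ _ _ _ _) smono sle m1 t ut.
  rewrite -!lee_fin fineK//.
  have eL : expR (- (m * t)) = expR (m * ln 2) * expR (- (m * - ln (1 - p))).
    by rewrite -expRD LE; congr expR; ring.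
  apply/andP; split.
    by apply: le_trans lo; rewrite lee_fin eL /C mulrA.
  apply: (le_trans up); rewrite lee_fin eL /K.
  have ln2 : 0 < ln 2 :> R by rewrite ln_gt0// ltr1n.
  have e1 : 0 < expR 1 :> R by exact: expR_gt0.
  have tm : (m - 1) * t + 1 <= m * - ln (1 - p) by rewrite LE in L1 *; nra.
  have poly : expR 1 * ((m - 1) * t + 1) + 1 <= (expR 1 * m + 1) * - ln (1 - p).
    by move: tm; rewrite -(ler_pM2l e1); lra.
  set E := expR (m * _) in eL *; set F := expR (- (m * - _)) in eL *.
  have EF : 0 < 2^-1 * E * F by rewrite !mulr_gt0 ?expR_gt0.
  move: poly; rewrite -(ler_pM2l EF); set l := ln (1 - p).
  (* Scaled by [E F / 2], [poly] agrees with the goal side by side. *)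
  congr (_ <= _); ring.
(* The conditioning event has probability exactly [e^(- t) / 2 = 1 - p], so [(1 - p) chi(p)] is the
   joint tail [J p]. *)
have chiE : \forall p \near (1 : R)^'-, chi X Y p = J p / (1 - p).
  near=> p.
  have [p1 L1 Lu] : [/\ p < 1, 1 <= - ln (1 - p) & u + ln 2 < - ln (1 - p)] by near: p.
  have [t [ut pE LE]] := quant p p1 Lu.
  have t0 : 0 < t := lt_trans hu ut.
  rewrite /chi /cond_prob; congr (_ / _).
  rewrite {1}pE laplace_quantile//.
  have -> : [set w | t < X w] = X @^-1` `]t, +oo[ by rewrite -ray.
  have -> : P (X @^-1` `]t, +oo[) = ccdf X t by [].
  by rewrite laplace_ccdf ?(ltW t0)//= pE; ring.
split.
- apply: cvg_trans (cvg_rate_div _ _ _ _ _ m1 C0 K0 hJ).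
  by apply: near_eq_cvg; near=> p; apply/esym; near: p.
- apply: cvg_trans (cvg_rate_ln _ _ _ _ _ m1 C0 K0 hJ).
  apply: near_eq_cvg; near=> p.
  have p1 : p < 1 by near: p; exact: nbhs_left_lt.
  have -> : chi X Y p = J p / (1 - p) by near: p.
  by rewrite [(1 - p) * _]mulrC divfK// gt_eqF// subr_gt0.
Unshelve. all: by end_near. Qed.
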